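(* If an element $\overline f\in k[[q]][q']$ is Taylor $\delta$-$p$-symmetric, then it has the form $$\overline f=\varphi_0(q)+\sum_{s\ge 0}\big(V^{s+1}(\varphi_{p^s}(q))\big)\left(\frac{q'}{q^p}\right)^{p^s}\in k((q))[q']$$ with $\varphi_0(q)\in k[[q]]$ and $\varphi_1(q),\varphi_p(q),\varphi_{p^2}(q),\dots\in qk[[q]]$ (all but finitely many of the $\varphi_{p^s}$ being zero, since $\overline f$ is a polynomial in $q'$).
   Context: $p\ge5$ is a prime and $k$ is an algebraic closure of $\mathbb F_p$. $q,q'$ are indeterminates. $V$ acts on $k((q))$ by $V(\sum a_mq^m)=\sum a_mq^{pm}$. For $j=1,\dots,p$ let $S_j\in\mathbb Z[q_1,\dots,q_p]$ be the $j$-th elementary symmetric polynomial and put $\delta S_j=\frac1p\big(S_j(q_1^p+pq_1',\dots,q_p^p+pq_p')-S_j(q_1,\dots,q_p)^p\big)\in\mathbb Z[q_1,\dots,q_p,q'_1,\dots,q'_p]$. The $k$-algebra map $k[[s_1,\dots,s_p]][s'_1,\dots,s'_p]\to k[[q_1,\dots,q_p]][q'_1,\dots,q'_p]$ given by $s_j\mapsto S_j$, $s'_j\mapsto\delta S_j$ (reduced mod $p$) is injective. An element $\overline f=\overline f(q,q')\in k[[q]][q']$ is called Taylor $\delta$-$p$-symmetric if $\Sigma_p\overline f:=\sum_{j=1}^p\overline f(q_j,q_j')$ lies in the image of this map. *)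

(* Defs.v *)
From HB Require Import structures.
From mathcomp Require Import all_boot all_order all_algebra.
From mathcomp Require Import boolp classical_sets cardinality fsbigop.
From mathcomp Require Import mpoly zify.

Set Implicit Arguments.
Unset Strict Implicit.
Unset Printing Implicit Defensive.

Import Order.TTheory GRing.Theory Num.Theory.
Local Open Scope ring_scope.

(** * The ring R[[q]] *)

Record pser (R : Type) := PSer { pcoef : nat -> R }.

HB.instance Definition _ (R : Type) := gen_eqMixin (pser R).
HB.instance Definition _ (R : Type) := gen_choiceMixin (pser R).

Lemma pserP (R : Type) (a b : pser R) : pcoef a =1 pcoef b <-> a = b.
Proof. by case: a b => [f] [g]; split=> [/= /funext-> //|[->]]. Qed.

Section PSer.
Context (R : comNzRingType).
Implicit Types a b c : pser R.

Definition pser_const (x : R) : pser R := PSer (fun m => if m == 0%N then x else 0).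
Definition pser_opp a : pser R := PSer (fun m => - pcoef a m).
Definition pser_add a b : pser R := PSer (fun m => pcoef a m + pcoef b m).
Definition pser_mul a b : pser R :=
  PSer (fun m => \sum_(j < m.+1) pcoef a j * pcoef b (m - j)).

Fact pser_addA : associative pser_add.
Proof. by move=> a b c; apply/pserP => m /=; rewrite addrA. Qed.
Fact pser_addC : commutative pser_add.
Proof. by move=> a b; apply/pserP => m /=; rewrite addrC. Qed.
Fact pser_add0 : left_id (pser_const 0) pser_add.
Proof. by move=> a; apply/pserP => m /=; rewrite if_same add0r. Qed.
Fact pser_addN : left_inverse (pser_const 0) pser_opp pser_add.
Proof. by move=> a; apply/pserP => m /=; rewrite if_same addNr. Qed.

HB.instance Definition _ := GRing.isZmodule.Build (pser R)
  pser_addA pser_addC pser_add0 pser_addN.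

Let trunc N a : {poly R} := \poly_(i < N) pcoef a i.

Let agree N (P Q : {poly R}) := forall m, (m < N)%N -> P`_m = Q`_m.

Let agreeM N P P' Q Q' : agree N P P' -> agree N Q Q' -> agree N (P * Q) (P' * Q').
Proof.
move=> hP hQ m mN; rewrite !coefM; apply: eq_bigr => j _; congr (_ * _).
  by apply: hP; apply: leq_trans mN; apply: ltn_ord.
by apply: hQ; apply: leq_ltn_trans mN; apply: leq_subr.
Qed.

Let truncM N a b : agree N (trunc N (pser_mul a b)) (trunc N a * trunc N b).
Proof.
move=> m mN; rewrite coef_poly mN coefM; apply: eq_bigr => j _.
rewrite !coef_poly (leq_trans (ltn_ord j) mN).
by rewrite (leq_ltn_trans (leq_subr _ _) mN).
Qed.

Let trunc_inj a b : (forall N, agree N (trunc N a) (trunc N b)) -> a = b.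
Proof.
move=> h; apply/pserP => m; have := h m.+1 m (ltnSn m).
by rewrite !coef_poly ltnSn.
Qed.

Fact pser_mulA : associative pser_mul.
Proof.
move=> a b c; apply: trunc_inj => N m mN; rewrite !truncM//.
rewrite (@agreeM N (trunc N a) (trunc N a) _ _ _ (@truncM N b c))//.
by rewrite [RHS](@agreeM N _ _ (trunc N c) (trunc N c) (@truncM N a b))// mulrA.
Qed.
Fact pser_mulC : commutative pser_mul.
Proof. by move=> a b; apply: trunc_inj => N m mN; rewrite !truncM// mulrC. Qed.
Fact pser_mul1 : left_id (pser_const 1) pser_mul.
Proof.
move=> a; apply/pserP => m /=; rewrite big_ord_recl big1 /=.
  by rewrite mul1r addr0 subn0.
by move=> i _; rewrite /bump /= mul0r.
Qed.
Fact pser_mulD : left_distributive pser_mul pser_add.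
Proof.
move=> a b c; apply/pserP => m /=; rewrite -big_split /=.
by apply: eq_bigr => j _; rewrite mulrDl.
Qed.
Fact pser_1neq0 : pser_const 1 != 0 :> pser R.
Proof. by apply/eqP => /pserP/(_ 0%N)/eqP; rewrite /= oner_eq0. Qed.

HB.instance Definition _ := GRing.Zmodule_isComNzRing.Build (pser R)
  pser_mulA pser_mulC pser_mul1 pser_mulD pser_1neq0.

Definition pserX : pser R := PSer (fun m => (m == 1%N)%:R).

End PSer.
Arguments pserX {R}.

(** * The ring R((q)) *)

Record laurent (R : nmodType) := Laurent {
  lcoef : int -> R;
  lcoef_bounded : exists N : nat, forall i : int, i < - N%:Z -> lcoef i = 0 }.

HB.instance Definition _ (R : nmodType) := gen_eqMixin (laurent R).
HB.instance Definition _ (R : nmodType) := gen_choiceMixin (laurent R).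

Lemma laurentP (R : nmodType) (a b : laurent R) : lcoef a =1 lcoef b <-> a = b.
Proof.
case: a b => [f hf] [g hg]; split=> [/= fg|->//].
have {}fg : f = g by apply/funext.
by case: _ / fg in hg *; rewrite (Prop_irrelevance hf hg).
Qed.

Section Laurent.
Context (R : comNzRingType).
Implicit Types (a b c : laurent R) (x y : pser R) (i j : int).

(* x / q^N *)
Fact pser_shift_subproof (N : nat) x : exists N0 : nat, forall i, i < - N0%:Z ->
  (if i + N%:Z is Posz m then pcoef x m else 0) = 0.
Proof.
exists N => i iN; have : i + N%:Z < 0 by rewrite -ltrBrDr sub0r.
by case: (i + N%:Z).
Qed.
Definition pser_shift (N : nat) x : laurent R := Laurent (pser_shift_subproof N x).

Let lcoef_shift N x (m : nat) : lcoef (pser_shift N x) (m%:Z - N%:Z) = pcoef x m.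
Proof. by rewrite /= subrK. Qed.

Let lcoef_shiftN N x i : i < - N%:Z -> lcoef (pser_shift N x) i = 0.
Proof.
move=> iN /=; have : i + N%:Z < 0 by rewrite -ltrBrDr sub0r.
by case: (i + N%:Z).
Qed.

Lemma pser_shift_surj a : exists N0 : nat, forall N : nat, (N0 <= N)%N ->
  exists x, a = pser_shift N x.
Proof.
have [N0 aN0] := lcoef_bounded a; exists N0 => N N0N.
exists (PSer (fun m => lcoef a (m%:Z - N%:Z))).
apply/laurentP => i /=; case E: (i + N%:Z) => [m|m].
  by rewrite -[m%:Z]E addrK.
apply: aN0; apply: (@lt_le_trans _ _ (- N%:Z)); last by rewrite lerN2 lez_nat.
by rewrite -(ltrD2r N%:Z) addNr E.
Qed.

Definition lconst (x : R) : laurent R := pser_shift 0 (pser_const x).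

Fact lopp_subproof a : exists N : nat, forall i, i < - N%:Z -> - lcoef a i = 0.
Proof. by have [N h] := lcoef_bounded a; exists N => i /h->; rewrite oppr0. Qed.
Definition lopp a : laurent R := Laurent (lopp_subproof a).

Fact ladd_subproof a b :
  exists N : nat, forall i, i < - N%:Z -> lcoef a i + lcoef b i = 0.
Proof.
have [N h] := lcoef_bounded a; have [M k] := lcoef_bounded b.
exists (maxn N M) => i iNM; rewrite h ?k ?addr0//.
  by apply: lt_le_trans iNM _; rewrite lerN2 lez_nat leq_maxr.
by apply: lt_le_trans iNM _; rewrite lerN2 lez_nat leq_maxl.
Qed.
Definition ladd a b : laurent R := Laurent (ladd_subproof a b).

(* A sum over all of Z of finite support. *)
Definition lmul_coef a b i : R :=
  \sum_(j \in [set: int]%classic) lcoef a j * lcoef b (i - j).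

Lemma lmul_coef_shift N M x y :
  lmul_coef (pser_shift N x) (pser_shift M y) =1 lcoef (pser_shift (N + M) (x * y)).
Proof.
move=> i; rewrite /lmul_coef; case E: (i + (N + M)%:Z) => [t|t]; last first.
  rewrite fsbig1 ?[RHS]/= ?E// => j _.
  have [jN|Nj] := ltP j (- N%:Z); first by rewrite lcoef_shiftN// mul0r.
  by rewrite [X in _ * X]lcoef_shiftN ?mulr0//; lia.
rewrite [RHS]/= E.
rewrite (@fsbigE _ _ _ _ _ [seq (val k)%:Z - N%:Z | k <- index_enum 'I_t.+1])//.
- rewrite big_map; under eq_bigl do rewrite in_setT.
  apply: eq_bigr => k _; rewrite lcoef_shift; congr (_ * _).
  have -> : i - ((val k)%:Z - N%:Z) = (t - k)%N%:Z - M%:Z.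
    by move: (ltn_ord k) => /=; lia.
  exact: lcoef_shift.
- rewrite map_inj_uniq ?index_enum_uniq// => k l /addIr[] ?; exact: val_inj.
move=> j _ jr; have [jN|Nj] := ltP j (- N%:Z); first by rewrite lcoef_shiftN// mul0r.
case Ej: (j + N%:Z) => [s|s]; last first.
  by move: Nj; rewrite -(lerD2r N%:Z) addNr Ej.
have jE : j = s%:Z - N%:Z by rewrite -[s%:Z]Ej addrK.
have ts : (t < s)%N.
  rewrite ltnNge; apply: contra jr => st; apply/mapP.
  by exists (Ordinal (st : s < t.+1)%N); rewrite ?mem_index_enum.
by rewrite [X in _ * X]lcoef_shiftN ?mulr0//; lia.
Qed.

Fact lmul_subproof a b :
  exists N : nat, forall i, i < - N%:Z -> lmul_coef a b i = 0.
Proof.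
have [N /(_ N (leqnn N))[x ->]] := pser_shift_surj a.
have [M /(_ M (leqnn M))[y ->]] := pser_shift_surj b.
by exists (N + M)%N => i iNM; rewrite lmul_coef_shift lcoef_shiftN.
Qed.
Definition lmul a b : laurent R := Laurent (lmul_subproof a b).

Lemma lmul_shift N M x y :
  lmul (pser_shift N x) (pser_shift M y) = pser_shift (N + M) (x * y).
Proof. exact/laurentP/lmul_coef_shift. Qed.

Lemma ladd_shift N x y : ladd (pser_shift N x) (pser_shift N y) = pser_shift N (x + y).
Proof. by apply/laurentP => i /=; case: (i + N%:Z) => // m; rewrite addr0. Qed.

Fact laddA : associative ladd.
Proof. by move=> a b c; apply/laurentP => m /=; rewrite addrA. Qed.
Fact laddC : commutative ladd.
Proof. by move=> a b; apply/laurentP => m /=; rewrite addrC. Qed.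
Fact ladd0 : left_id (lconst 0) ladd.
Proof.
by move=> a; apply/laurentP => -[m|m]; rewrite /= ?addr0 ?if_same add0r.
Qed.
Fact laddN : left_inverse (lconst 0) lopp ladd.
Proof.
by move=> a; apply/laurentP => -[m|m]; rewrite /= addNr ?addr0 ?if_same.
Qed.

HB.instance Definition _ := GRing.isZmodule.Build (laurent R)
  laddA laddC ladd0 laddN.

Fact lmulA : associative lmul.
Proof.
move=> a b c.
have [N /(_ N (leqnn N))[x ->]] := pser_shift_surj a.
have [M /(_ M (leqnn M))[y ->]] := pser_shift_surj b.
have [P /(_ P (leqnn P))[z ->]] := pser_shift_surj c.
by rewrite !lmul_shift mulrA addnA.
Qed.
Fact lmulC : commutative lmul.
Proof.
move=> a b.
have [N /(_ N (leqnn N))[x ->]] := pser_shift_surj a.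
have [M /(_ M (leqnn M))[y ->]] := pser_shift_surj b.
by rewrite !lmul_shift mulrC addnC.
Qed.
Fact lmul1 : left_id (lconst 1) lmul.
Proof.
move=> a; have [N /(_ N (leqnn N))[x ->]] := pser_shift_surj a.
by rewrite lmul_shift mul1r.
Qed.
Fact lmulD : left_distributive lmul ladd.
Proof.
move=> a b c.
have [N hN] := pser_shift_surj a; have [M hM] := pser_shift_surj b.
have [x ->] := hN (maxn N M) (leq_maxl _ _).
have [y ->] := hM (maxn N M) (leq_maxr _ _).
have [P /(_ P (leqnn P))[z ->]] := pser_shift_surj c.
by rewrite ladd_shift !lmul_shift ladd_shift mulrDl.
Qed.
Fact l1neq0 : lconst 1 != 0 :> laurent R.
Proof. by apply/eqP => /laurentP/(_ 0)/eqP; rewrite /= oner_eq0. Qed.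

HB.instance Definition _ := GRing.Zmodule_isComNzRing.Build (laurent R)
  lmulA lmulC lmul1 lmulD l1neq0.

Definition laurent_of_pser x : laurent R := pser_shift 0 x.

(* The monomial q^i; the exponent may be negative. *)
Fact lmono_subproof i :
  exists N : nat, forall j, j < - N%:Z -> (j == i)%:R = 0 :> R.
Proof. by exists `|i|%N => j ji; case: eqP => // ?; lia. Qed.
Definition lmono i : laurent R := Laurent (lmono_subproof i).

Lemma lmonoE i N (n : nat) : i = n%:Z - N%:Z ->
  lmono i = pser_shift N (PSer (fun m => (m == n)%:R)).
Proof.
move=> iE; apply/laurentP => j /=.
case E: (j + N%:Z) => [m|m]; last by case: eqP => // ?; lia.
by congr (_%:R); congr nat_of_bool; apply/eqP/eqP => ?; lia.
Qed.

Lemma lmono0 : lmono 0 = 1.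
Proof. by apply/laurentP => -[[|m]|m]. Qed.

Lemma lmonoD i j : lmono (i + j) = lmono i * lmono j.
Proof.
have rep (l : int) : exists n N : nat, l = n%:Z - N%:Z.
  by exists `|Num.max l 0|%N, `|Num.min l 0|%N; lia.
have [n [N iE]] := rep i; have [m [M jE]] := rep j.
rewrite (lmonoE iE) (lmonoE jE) (@lmonoE _ (N + M) (n + m)); last by lia.
rewrite [RHS]lmul_shift; congr pser_shift; apply/pserP => t /=.
have [nt|tn] := leqP n t; last first.
  rewrite big1 ?ltn_eqF//; first by apply: ltn_addr.
  move=> k _; rewrite ltn_eqF ?mul0r//.
  by apply: leq_ltn_trans tn; rewrite leq_ord.
rewrite (bigD1 (Ordinal (nt : n < t.+1)%N))//= eqxx mul1r big1 ?addr0.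
  by congr (_%:R); congr nat_of_bool; apply/eqP/eqP => ?; lia.
by move=> k kn; rewrite -[(k : nat) == n]/(k == Ordinal (nt : n < t.+1)%N) (negbTE kn) mul0r.
Qed.

Fact lV_subproof (p : nat) a : exists N : nat, forall i, i < - N%:Z ->
  (if (p%:Z %| i)%Z then lcoef a (i %/ p%:Z)%Z else 0) = 0.
Proof.
have [N aN] := lcoef_bounded a; exists (N * p)%N => i iNp.
case: ifP => // /dvdzP[j ij]; rewrite {}ij in iNp *; apply: aN.
have [p0|p0] := posnP p; first by move: iNp; rewrite p0 !mulr0 muln0 ltxx.
rewrite mulzK; last by lia.
by move: iNp; rewrite PoszM -mulNr ltr_pM2r.
Qed.
(* sum_m a_m q^m |-> sum_m a_m q^(pm) *)
Definition lV (p : nat) a : laurent R := Laurent (lV_subproof p a).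

End Laurent.
Arguments lmono {R}.
Arguments laurent_of_pser {R}.

(** * The ring R[[q_1, ..., q_n]] *)

Record mpser (n : nat) (R : Type) := MPSer { mpcoef : 'X_{1..n} -> R }.

HB.instance Definition _ (n : nat) (R : Type) := gen_eqMixin (mpser n R).
HB.instance Definition _ (n : nat) (R : Type) := gen_choiceMixin (mpser n R).

Lemma mpserP n (R : Type) (a b : mpser n R) : mpcoef a =1 mpcoef b <-> a = b.
Proof. by case: a b => [f] [g]; split=> [/= /funext-> //|[->]]. Qed.

Section MPSer.
Context (n : nat) (R : comNzRingType).
Implicit Types a b c : mpser n R.

Definition mpser_const (x : R) : mpser n R :=
  MPSer (fun m => if m == 0%MM then x else 0).
Definition mpser_opp a : mpser n R := MPSer (fun m => - mpcoef a m).
Definition mpser_add a b : mpser n R := MPSer (fun m => mpcoef a m + mpcoef b m).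
Definition mpser_mul a b : mpser n R := MPSer (fun m =>
  \sum_(k : 'X_{1..n < (mdeg m).+1, (mdeg m).+1} | m == (k.1 + k.2)%MM)
     mpcoef a k.1 * mpcoef b k.2).

Fact mpser_addA : associative mpser_add.
Proof. by move=> a b c; apply/mpserP => m /=; rewrite addrA. Qed.
Fact mpser_addC : commutative mpser_add.
Proof. by move=> a b; apply/mpserP => m /=; rewrite addrC. Qed.
Fact mpser_add0 : left_id (mpser_const 0) mpser_add.
Proof. by move=> a; apply/mpserP => m /=; rewrite if_same add0r. Qed.
Fact mpser_addN : left_inverse (mpser_const 0) mpser_opp mpser_add.
Proof. by move=> a; apply/mpserP => m /=; rewrite if_same addNr. Qed.

HB.instance Definition _ := GRing.isZmodule.Build (mpser n R)
  mpser_addA mpser_addC mpser_add0 mpser_addN.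

Let trunc N a : {mpoly R[n]} := \sum_(m : 'X_{1..n < N}) mpcoef a m *: 'X_[m].

Let coef_trunc N a m : (mdeg m < N)%N -> (trunc N a)@_m = mpcoef a m.
Proof.
move=> mN; rewrite /trunc raddf_sum /= (bigD1 (BMultinom mN))//= big1.
  by rewrite addr0 mcoeffZ mcoeffX eqxx mulr1.
move=> k; rewrite -val_eqE /= => /negbTE km.
by rewrite mcoeffZ mcoeffX km mulr0.
Qed.

Let agree N (P Q : {mpoly R[n]}) := forall m, (mdeg m < N)%N -> P@_m = Q@_m.

Let agreeM N P P' Q Q' : agree N P P' -> agree N Q Q' -> agree N (P * Q) (P' * Q').
Proof.
move=> hP hQ m mN; rewrite !mcoeffM; apply: eq_bigr => k _.
by rewrite hP ?hQ//; apply: leq_trans mN; apply: bmdeg.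
Qed.

Let truncM N a b : agree N (trunc N (mpser_mul a b)) (trunc N a * trunc N b).
Proof.
move=> m mN; rewrite coef_trunc// mcoeffM; apply: eq_bigr => k _.
by rewrite !coef_trunc//; apply: leq_trans mN; apply: bmdeg.
Qed.

Let trunc_inj a b : (forall N, agree N (trunc N a) (trunc N b)) -> a = b.
Proof.
move=> h; apply/mpserP => m; have := h (mdeg m).+1 m (ltnSn _).
by rewrite !coef_trunc.
Qed.

Fact mpser_mulA : associative mpser_mul.
Proof.
move=> a b c; apply: trunc_inj => N m mN; rewrite !truncM//.
rewrite (@agreeM N (trunc N a) (trunc N a) _ _ _ (@truncM N b c))//.
by rewrite [RHS](@agreeM N _ _ (trunc N c) (trunc N c) (@truncM N a b))// mulrA.
Qed.
Fact mpser_mulC : commutative mpser_mul.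
Proof. by move=> a b; apply: trunc_inj => N m mN; rewrite !truncM// mulrC. Qed.
Fact mpser_mul1 : left_id (mpser_const 1) mpser_mul.
Proof.
move=> a; apply: trunc_inj => N m mN; rewrite truncM//.
rewrite (@agreeM N _ 1 (trunc N a) (trunc N a))// ?mul1r// => k kN.
by rewrite coef_trunc//= mcoeff1; case: eqP.
Qed.
Fact mpser_mulD : left_distributive mpser_mul mpser_add.
Proof.
move=> a b c; apply/mpserP => m /=; rewrite -big_split /=.
by apply: eq_bigr => j _; rewrite mulrDl.
Qed.
Fact mpser_1neq0 : mpser_const 1 != 0 :> mpser n R.
Proof.
by apply/eqP => /mpserP/(_ 0%MM)/eqP; rewrite /= eqxx oner_eq0.
Qed.

HB.instance Definition _ := GRing.Zmodule_isComNzRing.Build (mpser n R)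
  mpser_mulA mpser_mulC mpser_mul1 mpser_mulD mpser_1neq0.

Definition mpser_of_mpoly (P : {mpoly R[n]}) : mpser n R :=
  MPSer (fun m => P@_m).

(* The image a(q_i) of a(q) under q |-> q_i. *)
Definition pser_at (i : 'I_n) (x : pser R) : mpser n R :=
  MPSer (fun m => if m == (U_(i) *+ m i)%MM then pcoef x (m i) else 0).

End MPSer.

(* The substitution s_j |-> S j, for series S j without constant term: the
   product of the S j ^+ e j then has order at least mdeg e, hence only the
   exponents e with mdeg e <= mdeg m contribute to the coefficient at m. *)
Definition mpser_subst (r n : nat) (R : comNzRingType) (S : 'I_r -> mpser n R)
    (g : mpser r R) : mpser n R :=
  MPSer (fun m => \sum_(e : 'X_{1..r < (mdeg m).+1})
                     mpcoef g e * mpcoef (mmap1 S e) m).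

(** * The p-derivation delta on Z[q_1, ..., q_n] *)

Section Delta.
Context (p n : nat).
Implicit Types P : {mpoly int[n]}.

(* In {mpoly int[n + n]}, the first n variables are the q_i and the last n
   variables are the q'_i. *)
Definition delta_num P : {mpoly int[n + n]} :=
  (P \mPo [tuple 'X_(lshift n i) ^+ p + 'X_(rshift n i) *+ p | i < n])
  - (P \mPo [tuple 'X_(lshift n i) | i < n]) ^+ p.

Definition delta P : {mpoly int[n + n]} :=
  \sum_(m <- msupp (delta_num P)) ((delta_num P)@_m %/ p%:Z)%Z *: 'X_[m].

Lemma deltaE P : prime p -> delta P *+ p = delta_num P.
Proof.
move=> p_pr; pose red : {mpoly int[n + n]} -> {mpoly 'F_p[n + n]} :=
  map_mpoly (intr : int -> 'F_p).
have chF : p \in [pchar 'F_p] by apply: pchar_Fp.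
have chM : p \in [pchar {mpoly 'F_p[n + n]}].
  exact: (rmorph_pchar (mpolyC (n + n) (R := 'F_p)) chF).
have redV m : red ('X_[m] \mPo [tuple 'X_(lshift n i) ^+ p + 'X_(rshift n i) *+ p | i < n])
    = pFrobenius_aut chM (red ('X_[m] \mPo [tuple 'X_(lshift n i) | i < n])).
  rewrite !comp_mpolyX [red _]rmorph_prod [red _ in RHS]rmorph_prod rmorph_prod /=.
  apply: eq_bigr => i _; rewrite !tnth_mktuple !rmorphXn /=; congr (_ ^+ _).
  by rewrite rmorphD rmorphMn /= -mulr_natr (pcharf0 chM) mulr0 addr0 rmorphXn.
have red0 : red (delta_num P) = 0.
  rewrite /red raddfB /= rmorphXn /= -/red; apply/eqP; rewrite subr_eq0; apply/eqP.
  rewrite -[RHS]/(pFrobenius_aut chM (red _)).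
  elim/mpolyind: P => [|c m Q _ _ IH]; first by rewrite !comp_mpoly0 /red !raddf0.
  rewrite !comp_mpolyD -[c]intz !scaler_int /red !raddfD /= -/red IH; congr (_ + _).
  have redMz t : red ('X_[m] *~ c \mPo t) = red ('X_[m] \mPo t) *~ c.
    rewrite -[_ *~ c \mPo t]/((comp_mpoly t) ('X_[m] *~ c)) (raddfMz (comp_mpoly t)).
    exact: (raddfMz (map_mpoly (intr : int -> 'F_p))).
  by rewrite !redMz raddfMz /= redV.
have dvd m : (p%:Z %| (delta_num P)@_m)%Z.
  by rewrite (dvdz_pcharf chF) -mcoeff_map_mpoly -/(red _) red0 mcoeff0.
rewrite [RHS]mpolyE /delta -sumrMnl; apply: eq_bigr => m _.
by rewrite -scaler_nat scalerA mulrC natz divzK.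
Qed.

End Delta.

(** * Taylor delta-p-symmetric elements of k[[q]][q'] *)

Section Taylor.
Context (p : nat) (k : comNzRingType).

(* Here k[[q_1, ..., q_p]][q'_1, ..., q'_p] is {mpoly (mpser p k)[p]}, with
   'X_i standing for q'_i. *)
Definition qvar (i : 'I_p) : mpser p k := mpser_of_mpoly 'X_i.

Definition base_change (P : {mpoly int[p + p]}) : {mpoly (mpser p k)[p]} :=
  mmap intr (fun i => match split i with
                      | inl i1 => (qvar i1)%:MP
                      | inr i2 => 'X_i2
                      end) P.

(* The elementary symmetric polynomials S_1, ..., S_p are indexed by 'I_p. *)
Definition sym_ser (j : 'I_p) : mpser p k :=
  mpser_of_mpoly (map_mpoly intr (mesym p int j.+1)).

Definition delta_sym (j : 'I_p) : {mpoly (mpser p k)[p]} :=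
  base_change (delta p (mesym p int j.+1)).

(* s_j |-> S_j, s'_j |-> delta S_j *)
Definition sym_map (G : {mpoly (mpser p k)[p]}) : {mpoly (mpser p k)[p]} :=
  mmap (fun g => (mpser_subst sym_ser g)%:MP) delta_sym G.

Definition Sigma_p (f : {poly (pser k)}) : {mpoly (mpser p k)[p]} :=
  \sum_(j < p) (map_poly (fun a => (pser_at j a)%:MP) f).['X_j].

Definition taylor_delta_symmetric (f : {poly (pser k)}) : Prop :=
  exists G : {mpoly (mpser p k)[p]}, sym_map G = Sigma_p f.

End Taylor.

(* Main.v *)
(* Only the dependence of Sigma_p f on (q_1, q'_1) and (q_2, q'_2) matters.
   Write x = q_1, y = q_2, D = (x - y)^p = x^p - y^p.  Since S_j is an affine
   combination of x + y and x y, modulo p the delta S_j depend on q'_1, q'_2 only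
   through q'_1 + q'_2 and y^p q'_1 + x^p q'_2.  Substituting q'_1 = W (D - Z),
   q'_2 = W Z and q'_i = 0 otherwise makes both a multiple of W D, so for n > 0
   the coefficient of W^n in Sigma_p f is divisible by D^n:
     f_n(x) (D - Z)^n + f_n(y) Z^n = D^n h_n(Z),   where f = sum_n f_n(q) q'^n.
   The coefficient of Z^j with 0 < j < n shows that f_n = 0 unless all these
   binomials C(n, j) vanish mod p, i.e. unless n is a power of p.  The coefficient
   of Z^n shows that (x - y)^(pn) divides f_n(y) +- f_n(x), whence f_n is a series in
   q^(pn) when n is a power of p.  Both divisibilities are tested on homogeneous
   parts evaluated at x = 1 + T, y = 1, where x - y becomes T. *)
Require Import Defs.
From mathcomp Require Import all_boot all_order all_algebra.
From mathcomp Require Import boolp classical_sets cardinality fsbigop.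
From mathcomp Require Import mpoly zify ring.

Set Implicit Arguments.
Unset Strict Implicit.
Unset Printing Implicit Defensive.

Import GRing.Theory.
Local Open Scope ring_scope.

(** * Evaluations of integer polynomials in commutative rings *)

Lemma int_mpoly_rmorphE (n : nat) (R : comNzRingType)
    (phi : {rmorphism {mpoly int[n]} -> R}) (P : {mpoly int[n]}) :
  phi P = mmap intr (fun i => phi 'X_i) P.
Proof.
rewrite {1}[P]mpolyE raddf_sum; apply: eq_bigr => m _.
rewrite -mul_mpolyC [LHS](rmorphM phi); congr (_ * _).
  by rewrite -[in LHS](intz P@_m) (rmorph_int (mpolyC n (R := int))) [LHS](rmorph_int phi).
by rewrite mpolyXE_id [LHS](rmorph_prod phi); apply: eq_bigr => i _; rewrite rmorphXn.
Qed.

Lemma mmap_intr_eq (n : nat) (R : comNzRingType) (u v : 'I_n -> R)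
    (P : {mpoly int[n]}) :
  u =1 v -> mmap intr u P = mmap intr v P.
Proof. by move=> uv; apply: eq_bigr => m _; congr (_ * _); apply: mmap1_eq. Qed.

Lemma rmorph_mmap_intr (n : nat) (R S : comNzRingType)
    (phi : {rmorphism R -> S}) (v : 'I_n -> R) (P : {mpoly int[n]}) :
  phi (mmap intr v P) = mmap intr (fun i => phi (v i)) P.
Proof.
rewrite [LHS](int_mpoly_rmorphE (phi \o mmap intr v)).
by apply: mmap_intr_eq => i /=; rewrite mmapX mmap1U.
Qed.

Lemma mmap_intr_comp (n m : nat) (R : comNzRingType) (v : 'I_m -> R)
    (t : n.-tuple {mpoly int[m]}) (P : {mpoly int[n]}) :
  mmap intr v (P \mPo t) = mmap intr (fun i => mmap intr v (tnth t i)) P.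
Proof.
rewrite [LHS](int_mpoly_rmorphE (mmap intr v \o comp_mpoly t)).
by apply: mmap_intr_eq => i /=; rewrite comp_mpolyXU -tnth_nth.
Qed.

(** * Elementary symmetric polynomials and their [delta] when two variables move *)

Lemma mmap_mesym (n : nat) (R : comNzRingType) (v : 'I_n -> R) (j : nat) :
  mmap intr v (mesym n int j) = (\prod_i (v i *: 'X + 1))`_j.
Proof.
rewrite bigA_distr /= coef_sum raddf_sum [LHS]big_mkcond; apply: eq_bigr => h _ /=.
rewrite -big_mkcond scaler_prod prodr_const coefZ coefXn eq_sym.
case: eqP => _; rewrite ?mulr0// mulr1 [LHS](rmorph_prod (mmap intr v)).
by apply: eq_bigr => i _; rewrite /= mmapX mmap1U.
Qed.

(** In the generating product of the [w i *: 'X + 1], the factors away from [i0] and [i1] form a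
    fixed product [Q]. The coefficients are chosen before [w], so that one triple serves several
    evaluations. *)
Lemma mesym_two_vars (n : nat) (R S : comNzRingType) (phi : {rmorphism R -> S})
    (i0 i1 : 'I_n) (j : nat) (v : 'I_n -> R) :
  i0 != i1 ->
  exists c0 c1 c2 : R, forall w : 'I_n -> S,
    (forall i, i != i0 -> i != i1 -> w i = phi (v i)) ->
    mmap intr w (mesym n int j)
    = phi c0 + phi c1 * (w i0 + w i1) + phi c2 * (w i0 * w i1).
Proof.
move=> i01; pose Q := \prod_(i | (i != i0) && (i != i1)) (v i *: 'X + 1).
exists (Q`_j), ((Q * 'X)`_j), ((Q * 'X^2)`_j) => w wv.
rewrite mmap_mesym (bigD1 i0)//= (bigD1 i1) 1?eq_sym//=.
have -> : \prod_(i | (i != i0) && (i != i1)) (w i *: 'X + 1) = map_poly phi Q.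
  rewrite rmorph_prod; apply: eq_bigr => i /andP[? ?].
  by rewrite wv// rmorphD rmorph1 /= map_polyZ map_polyX.
set a := w i0; set b := w i1.
rewrite -!coef_map !rmorphM /= !map_polyX -expr2; set Q' := map_poly phi Q.
have -> : (a *: 'X + 1) * ((b *: 'X + 1) * Q')
    = Q' + (a + b) *: (Q' * 'X) + (a * b) *: (Q' * 'X^2).
  by rewrite -!mul_polyC !(polyCD, polyCM); ring.
by rewrite !coefD !coefZ; ring.
Qed.

Lemma mmap_delta (p n : nat) (R : comNzRingType) (h : 'I_(n + n) -> R)
    (P : {mpoly int[n]}) :
  prime p ->
  mmap intr h (delta p P) *+ p
  = mmap intr (fun i => h (lshift n i) ^+ p + h (rshift n i) *+ p) P
    - mmap intr (fun i => h (lshift n i)) P ^+ p.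
Proof.
move=> p_pr; pose F := mmap intr h.
rewrite -[LHS](raddfMn F) deltaE// [LHS](raddfB F).
rewrite [X in _ - X](rmorphXn F) /= !mmap_intr_comp; congr (_ - _ ^+ _).
  apply: mmap_intr_eq => i.
  rewrite tnth_mktuple raddfD raddfMn /= mmapX mmap1U; congr (_ + _).
  by rewrite [LHS](rmorphXn F) /= /F mmapX mmap1U.
by apply: mmap_intr_eq => i; rewrite tnth_mktuple mmapX mmap1U.
Qed.

Lemma split_lshift (m n : nat) (i : 'I_m) : split (lshift n i) = inl i.
Proof. by rewrite -[lshift n i]/(unsplit (inl i)) unsplitK. Qed.

Lemma split_rshift (m n : nat) (i : 'I_n) : split (rshift m i) = inr i.
Proof. by rewrite -[rshift m i]/(unsplit (inr i)) unsplitK. Qed.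

(* The two equations on r say that the tangent vector r, whose support is
   {i0, i1}, moves both the sum and the product of q_i0^p and q_i1^p by a
   multiple of c; up to p, it thus moves every delta S_j by a multiple of c. *)
Lemma delta_mesym_two_vars (p n : nat) (R : comNzRingType) (i0 i1 : 'I_n)
    (j : nat) (q r : 'I_n -> R) (c d : R) :
  prime p -> (forall x y : R, x *+ p = y *+ p -> x = y) -> i0 != i1 ->
  (forall i, i != i0 -> i != i1 -> r i = 0) ->
  r i0 + r i1 = c -> q i0 ^+ p * r i1 + q i1 ^+ p * r i0 = c * d ->
  exists (a e : R) (g : {poly R}),
    mmap intr (fun i => match split i with
                        | inl i1 => (q i1)%:P
                        | inr i2 => (r i2)%:P * 'X
                        end) (delta p (mesym n int j)) =
    a%:P + (c * e)%:P * 'X + g *+ p.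
Proof.
move=> p_pr p_inj i01 r0 rc qrc; pose s := mesym n int j.
pose h (i : 'I_(n + n)) : {poly R} :=
  match split i with inl i1 => (q i1)%:P | inr i2 => (r i2)%:P * 'X end.
pose h0 (i : 'I_(n + n)) : R := match split i with inl i1 => q i1 | inr i2 => 0 end.
have [c0 [c1 [c2 sE]]] := mesym_two_vars (polyC (R := R)) j (fun i => q i ^+ p) i01.
(* [a] is the value at [r = 0]. In the product of the two [q i ^+ p + r i * X *+ p] the quadratic
   term carries p^2; division by p leaves [g *+ p]. *)
exists (mmap intr h0 (delta p s)), (c1 + c2 * d), ((c2 * (r i0 * r i1))%:P * 'X^2).
(* The identity is checked after multiplication by p, where [mmap_delta] turns [delta] into its
   numerator. *)
have p_injX (P Q : {poly R}) : P *+ p = Q *+ p -> P = Q.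
  move=> PQ; apply/polyP => i; apply: p_inj.
  by rewrite -!coefMn PQ.
apply: p_injX; rewrite -/h !mulrnDl mmap_delta// -polyCMn mmap_delta//.
rewrite polyCB polyC_exp !rmorph_mmap_intr.
rewrite [X in X - _ = _]sE 1?[X in _ = X - _ + _ + _]sE => [|i i_i0 i_i1|i i_i0 i_i1]; last 2 first.
- by rewrite /h0 split_lshift split_rshift mul0rn addr0.
- by rewrite /h split_lshift split_rshift r0// mul0r mul0rn addr0 /= polyC_exp.
rewrite /=.
have -> : mmap intr (fun i => h (lshift n i)) s = mmap intr (fun i => (h0 (lshift n i))%:P) s.
  by apply: mmap_intr_eq => i; rewrite /h /h0 !split_lshift.
move: (mmap _ _ _) => z; rewrite /h /h0 !split_lshift !split_rshift !mul0rn !addr0.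
have -> : c * (c1 + c2 * d) =
    c1 * (r i0 + r i1) + c2 * (q i0 ^+ p * r i1 + q i1 ^+ p * r i0).
  by rewrite qrc rc; ring.
have [u uE] : exists u : {poly R}, forall x, x *+ p = u * x.
  by exists p%:R => x; rewrite mulr_natl.
rewrite !uE -!(polyC_exp p) !(polyCD, polyCM).
move: (q i0 ^+ p)%:P (q i1 ^+ p)%:P (z ^+ p) => x y t.
move: c0%:P c1%:P c2%:P (r i0)%:P (r i1)%:P 'X => C0 C1 C2 s0 s1 X; ring.
Qed.

(** * Reduction to characteristic p and the relation between f_n(x) and f_n(y) *)

Lemma coef_comp_polyZX (R : comNzRingType) (P : {poly R}) (d : R) (n : nat) :
  (P \Po (d *: 'X))`_n = d ^+ n * P`_n.
Proof.
rewrite coef_comp_poly; under eq_bigr => i _ do rewrite exprZn coefZ coefXn.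
have [nP|Pn] := ltnP n (size P); last first.
  rewrite [in RHS]nth_default// mulr0 big1// => i _.
  by rewrite gtn_eqF ?mulr0//; apply: leq_trans Pn.
rewrite (bigD1 (Ordinal nP))//= eqxx mulr1 mulrC big1 ?addr0// => i.
by rewrite -val_eqE /= eq_sym => /negbTE->; rewrite !mulr0.
Qed.

Lemma mpcoefMn (n : nat) (R : comNzRingType) (a : mpser n R) (j : nat) m :
  mpcoef (a *+ j) m = mpcoef a m *+ j.
Proof. by elim: j => [|j IH]; rewrite ?mulr0n /= ?if_same// !mulrS /= IH. Qed.

Lemma mpser_pchar (p n : nat) (R : comNzRingType) :
  p \in [pchar R] -> p \in [pchar (mpser n R)].
Proof.
move=> pR; rewrite inE (pcharf_prime pR) /=; apply/eqP/mpserP => m.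
by rewrite mpcoefMn -mulr_natl (pcharf0 pR) mul0r /= if_same.
Qed.

Lemma rmorph_subXp (p : nat) (R S : comNzRingType) (phi : {rmorphism R -> S})
    (x y : R) :
  p \in [pchar S] -> phi (x ^+ p - y ^+ p) = (phi x - phi y) ^+ p.
Proof.
move=> pS; rewrite rmorphB !rmorphXn /=.
by rewrite -!(pFrobenius_autE pS) rmorphB.
Qed.

(** Division by p takes place in [R], where p can be cancelled; [phi] then kills the multiple of p.
    What remains is affine with linear coefficient a multiple of [phi c], hence a polynomial in
    [phi c *: 'X]. *)
Lemma delta_mesym_two_vars_pchar (p n : nat) (R S : comNzRingType)
    (phi : {rmorphism R -> S}) (i0 i1 : 'I_n)
    (j : nat) (q r : 'I_n -> R) (c d : R) :
  p \in [pchar S] -> (forall x y : R, x *+ p = y *+ p -> x = y) -> i0 != i1 ->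
  (forall i, i != i0 -> i != i1 -> r i = 0) ->
  r i0 + r i1 = c -> q i0 ^+ p * r i1 + q i1 ^+ p * r i0 = c * d ->
  exists a e : S,
    mmap intr (fun i => match split i with
                        | inl i1 => (phi (q i1))%:P
                        | inr i2 => (phi (r i2))%:P * 'X
                        end) (delta p (mesym n int j)) =
    (a%:P + e%:P * 'X) \Po (phi c *: 'X).
Proof.
move=> pS p_inj i01 r0 rc qrc; have p_pr := pcharf_prime pS.
have [a [e [g E]]] := delta_mesym_two_vars j p_pr p_inj i01 r0 rc qrc.
exists (phi a), (phi e).
rewrite comp_polyD comp_polyM !comp_polyC comp_polyX -scalerAr mul_polyC scalerA.
have := congr1 (map_poly phi) E; rewrite rmorph_mmap_intr.
rewrite !rmorphD rmorphMn /= -[X in _ + X]mulr_natl -polyC_natr (pcharf0 pS) mul0r addr0.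
rewrite map_polyC [map_poly _ (_ * _)]rmorphM /= map_polyC map_polyX /= [phi (c * e)]rmorphM mul_polyC.
move=> <-; apply: mmap_intr_eq => i; case: (split i) => l /=.
  by rewrite map_polyC.
by rewrite rmorphM /= map_polyC map_polyX.
Qed.

Lemma pser_at0 (n : nat) (R : comNzRingType) (i : 'I_n) :
  pser_at i (0 : pser R) = 0.
Proof. by apply/mpserP => m /=; rewrite !if_same. Qed.

Lemma taylor_delta_symmetric_two_vars (p : nat) (k : comNzRingType)
    (f : {poly (pser k)}) (i0 i1 : 'I_p) (n : nat) :
  p \in [pchar k] -> i0 != i1 -> (0 < n)%N -> taylor_delta_symmetric p f ->
  let D := (qvar k i0 - qvar k i1) ^+ p in
  exists h : {poly mpser p k},
    (pser_at i0 f`_n)%:P * (D%:P - 'X) ^+ n + (pser_at i1 f`_n)%:P * 'X^n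
    = D%:P ^+ n * h.
Proof.
move=> pk i01 n_gt0 [G symG] D; set B := mpser p k in D *.
have p_pr := pcharf_prime pk.
have pB : p \in [pchar B] := mpser_pchar p pk.
(* Z[q_1, ..., q_p][Z] has no p-torsion; [phi] below maps it to polynomials in Z over series in
   characteristic p. *)
pose A := {poly {mpoly int[p]}}.
pose q i : A := ('X_i)%:P.
pose c := q i0 ^+ p - q i1 ^+ p.
pose r i := if i == i0 then c - 'X else if i == i1 then 'X else 0.
have p_inj (x y : A) : x *+ p = y *+ p -> x = y.
  move=> xy; apply/eqP; rewrite -subr_eq0; have : (x - y) * p%:R == 0.
    by rewrite mulr_natr mulrnBl xy subrr.
  rewrite mulf_eq0 => /orP[//|].
  by rewrite -!polyC_natr -mpolyC_nat polyC_eq0 mpolyC_eq0 Num.Theory.pnatr_eq0 eqn0Ngt prime_gt0.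
have rE0 : r i0 = c - 'X by rewrite /r eqxx.
have rE1 : r i1 = 'X by rewrite /r eqxx eq_sym (negbTE i01).
have r0 i : i != i0 -> i != i1 -> r i = 0 by rewrite /r => /negbTE-> /negbTE->.
have rc : r i0 + r i1 = c by rewrite rE0 rE1 subrK.
have qrc : q i0 ^+ p * r i1 + q i1 ^+ p * r i0 = c * (q i1 ^+ p + 'X).
  by rewrite rE0 rE1 /c; move: (q i0 ^+ p) (q i1 ^+ p) => x y; ring.
pose phi : {rmorphism A -> {poly B}} := map_poly (mmap intr (qvar k)).
(* The outer variable is W: q'_i goes to [phi (r i)] times W. *)
pose ev : {rmorphism {mpoly B[p]} -> {poly {poly B}}} :=
  mmap (polyC \o polyC) (fun i => (phi (r i))%:P * 'X).
have phiq i : phi (q i) = (qvar k i)%:P.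
  by rewrite /phi /= map_polyC /= mmapX mmap1U.
have pBX : p \in [pchar {poly B}] by exact: (rmorph_pchar (polyC (R := B)) pB).
have phic : phi c = D%:P.
  by rewrite [LHS](rmorph_subXp phi _ _ pBX) !phiq /D polyC_exp polyCB.
have evE j : exists ae : {poly {poly B}},
    ev (delta_sym k j) = ae \Po (D%:P *: 'X).
  have [a [e E]] := delta_mesym_two_vars_pchar phi j.+1 pBX p_inj i01 r0 rc qrc.
  exists (a%:P + e%:P * 'X); rewrite -phic -E [LHS](rmorph_mmap_intr ev).
  apply: mmap_intr_eq => i; case: (split i) => l.
    by rewrite phiq [LHS]mmapC.
  by rewrite [LHS]mmapX mmap1U.
have [ae {}evE] := fin_all_exists evE.
(* Substituted series are constants and each [delta_sym] becomes a polynomial in D W, hence so does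
   the whole image; its W^n coefficient is then divisible by D^n. *)
have evG : exists h : {poly {poly B}}, ev (sym_map G) = h \Po (D%:P *: 'X).
  exists (\sum_(m <- msupp G) (mpser_subst (@sym_ser p k) G@_m)%:P%:P * mmap1 ae m).
  rewrite raddf_sum [RHS](raddf_sum (comp_poly _)); apply: eq_bigr => m _.
  rewrite [LHS](rmorphM ev) [RHS](rmorphM (comp_poly _)) /=; congr (_ * _).
    by rewrite [LHS]mmapC comp_polyC.
  rewrite [LHS](rmorph_prod ev) [RHS](rmorph_prod (comp_poly _)).
  apply: eq_bigr => i _.
  by rewrite [LHS](rmorphXn ev) [RHS](rmorphXn (comp_poly _)) evE.
have [h evh] := evG; exists h`_n.
rewrite -coef_comp_polyZX -evh symG /Sigma_p raddf_sum coef_sum.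
have evS j : (ev (map_poly (fun a => (pser_at j a)%:MP) f).['X_j])`_n
    = (pser_at j f`_n)%:P * phi (r j) ^+ n.
  have evT l : (ev ((pser_at j f`_l)%:MP * 'X_j ^+ l))`_n
      = (pser_at j f`_l)%:P * phi (r j) ^+ l * (n == l)%:R.
    have -> : ev ((pser_at j f`_l)%:MP * 'X_j ^+ l)
        = (pser_at j f`_l)%:P%:P * ((phi (r j))%:P * 'X) ^+ l.
      rewrite [LHS](rmorphM ev); congr (_ * _); first exact: mmapC.
      by rewrite [LHS](rmorphXn ev) [ev _]mmapX mmap1U.
    by rewrite exprMn -polyC_exp mulrA -polyCM coefCM coefXn.
  rewrite /map_poly horner_poly [ev _](raddf_sum ev) coef_sum.
  under eq_bigr => l _ do rewrite evT.
  have [nf|fn] := ltnP n (size f); last first.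
    rewrite [f`_n]nth_default// pser_at0 polyC0 mul0r big1// => l _.
    by rewrite gtn_eqF ?mulr0//; apply: leq_trans fn.
  rewrite (bigD1 (Ordinal nf))//= eqxx mulr1 big1 ?addr0// => l.
  by rewrite -val_eqE /= eq_sym => /negbTE->; rewrite mulr0.
under eq_bigr => j _ do rewrite evS.
rewrite (bigD1 i0)//= (bigD1 i1) 1?eq_sym//= big1 ?addr0.
  by rewrite rE0 rE1 rmorphB phic /= map_polyX.
(* The other summands contain 0^n, which vanishes as n > 0. *)
by move=> j /andP[ji0 ji1]; rewrite r0// rmorph0 expr0n gtn_eqF// mulr0.
Qed.

(** * Binomial coefficients modulo p *)

Lemma coef_exprXD1 (R : comNzRingType) (n i : nat) :
  (('X + 1 : {poly R}) ^+ n)`_i = 'C(n, i)%:R.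
Proof.
rewrite addrC exprDn coef_sum; under eq_bigr => j _ do rewrite expr1n mul1r coefMn coefXn.
have [ni|ni] := ltnP n i.
  rewrite bin_small// big1// => j _; rewrite gtn_eqF ?mul0rn//.
  exact: leq_ltn_trans (leq_ord j) ni.
rewrite (bigD1 (Ordinal (ni : i < n.+1)%N))//= eqxx big1 ?addr0// => j.
by rewrite -val_eqE /= eq_sym => /negbTE->; rewrite mul0rn.
Qed.

Lemma coef_exprCsubX (R : comNzRingType) (c : R) (n i : nat) : (i <= n)%N ->
  ((c%:P - 'X) ^+ n)`_i = c ^+ (n - i) * (-1) ^+ i *+ 'C(n, i).
Proof.
move=> ni; have -> : - 'X = (- 1)%:P * 'X :> {poly R} by rewrite polyCN mulN1r.
have termE l : ((c%:P ^+ (n - l) * ((- 1)%:P * 'X) ^+ l) *+ 'C(n, l))`_i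
    = c ^+ (n - l) * (-1) ^+ l *+ 'C(n, l) * (i == l)%:R.
  by rewrite exprMn -!polyC_exp mulrA -polyCM coefMn coefCM coefXn mulrnAl.
rewrite exprDn coef_sum; under eq_bigr => l _ do rewrite termE.
rewrite (bigD1 (Ordinal (ni : (i < n.+1)%N)))//= eqxx mulr1 big1 ?addr0// => l.
by rewrite -val_eqE /= eq_sym => /negbTE->; rewrite mulr0.
Qed.

(** With q the p-part of m, (X + 1)^m = (X^q + 1)^(m/q) in characteristic p, so the coefficient of
    X^q is m/q, which is prime to p. *)
Lemma natr_bin_logn (p m : nat) (R : comNzRingType) :
  p \in [pchar R] -> (0 < m)%N -> ('C(m, p ^ logn p m))%:R != 0 :> R.
Proof.
move=> pR m_gt0; have p_pr := pcharf_prime pR; set q := (p ^ _)%N.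
have q_gt0 : (0 < q)%N by rewrite expn_gt0 prime_gt0.
have qm : (q %| m)%N := pfactor_dvdnn p m.
have pu : ~~ (p %| m %/ q)%N.
  by have [u] := pfactor_coprime p_pr m_gt0; rewrite prime_coprime// -/q => pu {1}->; rewrite mulnK.
rewrite -coef_exprXD1 -(divnK qm) mulnC exprM exprDn_pchar; last first.
  by rewrite pnatX pnatE// (rmorph_pchar (polyC (R := R)) pR).
rewrite expr1n.
have -> : ('X^q + 1 : {poly R}) = ('X + 1) \Po 'X^q.
  by rewrite comp_polyD comp_polyX comp_polyC.
rewrite -rmorphXn /= coef_comp_poly_Xn// dvdnn divnn q_gt0 coef_exprXD1 bin1.
by rewrite -(dvdn_pcharf pR).
Qed.

(** * Homogeneous parts of series in several variables *)

Section HomogeneousPart.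
Context (n : nat) (R : comNzRingType).
Implicit Types (a b : mpser n R) (i : 'I_n) (N : nat).

(** A power series cannot be evaluated at a point such as (1 + T, 1); its homogeneous parts are
    polynomials and can. *)
Definition hpart N a : {mpoly R[n]} :=
  \sum_(m : 'X_{1..n < N.+1} | mdeg m == N) mpcoef a m *: 'X_[m].

Lemma mcoeff_hpart N a m :
  (hpart N a)@_m = if mdeg m == N then mpcoef a m else 0.
Proof.
rewrite raddf_sum /=; under eq_bigr => l _ do rewrite mcoeffZ mcoeffX.
case: eqP => [mN|mN]; last first.
  rewrite big1// => l /eqP lN; case: eqP => [lm|_]; last exact: mulr0.
  by case: mN; rewrite -lm.
have lt_m : (mdeg m < N.+1)%N by rewrite mN.
rewrite (bigD1 (BMultinom lt_m)) /= ?mN// eqxx mulr1 big1 ?addr0// => l.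
by rewrite -val_eqE /= => /andP[_ /negbTE->]; rewrite mulr0.
Qed.

Lemma hpartD N a b : hpart N (a + b) = hpart N a + hpart N b.
Proof.
by apply/mpolyP => m; rewrite mcoeffD !mcoeff_hpart; case: ifP; rewrite ?addr0.
Qed.

Lemma hpartN N a : hpart N (- a) = - hpart N a.
Proof.
by apply/mpolyP => m; rewrite mcoeffN !mcoeff_hpart; case: ifP; rewrite ?oppr0.
Qed.

Lemma hpartMn N a (j : nat) : hpart N (a *+ j) = hpart N a *+ j.
Proof.
apply/mpolyP => m; rewrite mcoeffMn !mcoeff_hpart mpcoefMn.
by case: ifP; rewrite ?mul0rn.
Qed.

Lemma hpart_qvarM N i a :
  hpart N (qvar R i * a) = if N is N'.+1 then 'X_i * hpart N' a else 0.
Proof.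
apply/mpolyP => m; rewrite mcoeff_hpart.
have -> : mpcoef (qvar R i * a) m = ('X_i * hpart (mdeg m).-1 a)@_m.
  rewrite mcoeffM; apply: eq_bigr => l /eqP ml; rewrite /= mcoeffX mcoeff_hpart.
  case: eqP => [li|_]; last by rewrite !mul0r.
  have -> : (mdeg m).-1 = mdeg l.2; last by rewrite eqxx.
  by apply: etrans (congr1 (fun x => (mdeg x).-1) ml) _; rewrite mdegD -li mdeg1.
case: N => [|N].
  rewrite mcoeff0; case: eqP => // /eqP; rewrite mdeg_eq0 => /eqP->.
  by rewrite [LHS](rmorphM (mcoeff 0%MM)) /= mcoeffX mnm1_eq0 mul0r.
case: eqP => [->//|mN]; rewrite mcoeffM big1// => l /eqP ml.
rewrite mcoeffX mcoeff_hpart; case: eqP => [li|_]; last by rewrite mul0r.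
case: eqP => [lN|_]; last by rewrite mulr0.
by case: mN; apply: etrans (congr1 (@mdeg n) ml) _; rewrite mdegD -li mdeg1 lN.
Qed.

Lemma hpart_subXM N i0 i1 a (d : nat) :
  hpart N ((qvar R i0 - qvar R i1) ^+ d * a)
  = if (d <= N)%N then ('X_i0 - 'X_i1) ^+ d * hpart (N - d) a else 0.
Proof.
elim: d N => [|d IH] N; first by rewrite !expr0 !mul1r subn0.
rewrite exprS -mulrA mulrBl hpartD hpartN !hpart_qvarM.
case: N => [|N]; first by rewrite subrr.
rewrite !IH ltnS subSS; case: ifP => _; last by rewrite !mulr0 subrr.
by rewrite -mulrBl mulrA -exprS.
Qed.

Lemma hpart_pser_at N i (x : pser R) : hpart N (pser_at i x) = pcoef x N *: 'X_i ^+ N.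
Proof.
apply/mpolyP => m; rewrite mcoeffZ mpolyXn mcoeffX mcoeff_hpart /=.
have [<-|mN] := eqVneq (U_(i) *+ N)%MM m.
  by rewrite mdegMn mdeg1 mul1n eqxx mulmnE mnm1E eqxx mul1n eqxx mulr1.
rewrite mulr0; case: eqP => // mdN; case: eqP => // mE.
by case/eqP: mN; rewrite mE -mdN {1}mE mdegMn mdeg1 mul1n.
Qed.

End HomogeneousPart.

(** * Vanishing of coefficients of f, read off at x = 1 + T, y = 1 *)

Section Recognition.
Context (p : nat) (k : idomainType) (f : {poly (pser k)}) (i0 i1 : 'I_p).
Context (pk : p \in [pchar k]) (i01 : i0 != i1).
Context (f_sym : taylor_delta_symmetric p f).

Let v (i : 'I_p) : {poly k} := if i == i0 then 'X + 1 else 1.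

Let lambda N (a : mpser p k) : {poly k} := mmap polyC v (hpart N a).

Let lambdaD N a b : lambda N (a + b) = lambda N a + lambda N b.
Proof. by rewrite /lambda hpartD raddfD. Qed.

Let lambdaMn N a j : lambda N (a *+ j) = lambda N a *+ j.
Proof. by rewrite /lambda hpartMn raddfMn. Qed.

Let lambda_subXM N a (d : nat) :
  lambda N ((qvar k i0 - qvar k i1) ^+ d * a)
  = if (d <= N)%N then 'X^d * lambda (N - d) a else 0.
Proof.
rewrite /lambda hpart_subXM; case: ifP => _; last exact: raddf0.
rewrite [LHS]rmorphM; congr (_ * _); rewrite [LHS]rmorphXn; congr (_ ^+ _).
rewrite raddfB /= !mmapX !mmap1U /v eqxx eq_sym (negbTE i01).
by rewrite addrK.
Qed.

Let coef_lambda_subXM N a (d l : nat) : (l < d)%N ->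
  (lambda N ((qvar k i0 - qvar k i1) ^+ d * a))`_l = 0.
Proof.
by move=> ld; rewrite lambda_subXM; case: ifP => _; rewrite ?coef0// coefXnM ld.
Qed.

Let lambda0_pser_at N x : lambda N (pser_at i0 x) = pcoef x N *: ('X + 1) ^+ N.
Proof.
rewrite /lambda hpart_pser_at mmapZ mul_polyC; congr (_ *: _).
by rewrite [LHS]rmorphXn; congr (_ ^+ _); rewrite /= mmapX mmap1U /v eqxx.
Qed.

Let lambda1_pser_at N x : lambda N (pser_at i1 x) = (pcoef x N)%:P.
Proof.
rewrite /lambda hpart_pser_at mmapZ -[RHS]mulr1; congr (_ * _).
rewrite -[RHS](expr1n _ N) [LHS]rmorphXn; congr (_ ^+ _).
by rewrite /= mmapX mmap1U /v eq_sym (negbTE i01).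
Qed.

Let coef_two_vars (n j : nat) : (0 < n)%N -> (j <= n)%N ->
  exists b : mpser p k,
    (qvar k i0 - qvar k i1) ^+ (p * (n - j)) * (pser_at i0 f`_n *+ 'C(n, j))
    + (-1) ^+ j * pser_at i1 f`_n *+ (n == j)
    = (qvar k i0 - qvar k i1) ^+ (p * n) * b.
Proof.
move=> n_gt0 jn.
have [h E] := taylor_delta_symmetric_two_vars pk i01 n_gt0 f_sym.
(* The Z^j coefficient of (D - Z)^n has sign (-1)^j; multiplying by it moves the sign to the
   y-term. *)
exists ((-1) ^+ j * h`_j); have := congr1 (fun P : {poly _} => (-1) ^+ j * P`_j) E.
rewrite !exprM -polyC_exp coefCM coefD !coefCM coefXn (eq_sym j).
set D := (_ - _) ^+ p.
rewrite coef_exprCsubX//.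
rewrite mulrDr -mulr_natr; move: (D ^+ (n - j)) (D ^+ n) => d e.
move=> EE; rewrite [RHS]mulrCA -EE mulrA -[_ *+ 'C(_, _)]mulr_natr -signr_odd.
by case: (odd j); rewrite ?expr0 ?expr1; ring.
Qed.

(** For 0 < j < n the coefficient of Z^j has no y-term: C(n, j) f_n(x) (x - y)^(p(n-j)) is divisible
    by the higher power (x - y)^(pn). *)
Lemma coef_taylor_delta_symmetric0 (n j : nat) :
  (0 < j < n)%N -> 'C(n, j)%:R != 0 :> k -> f`_n = 0.
Proof.
move=> /andP[j_gt0 jn] Cnj; have n_gt0 := ltn_trans j_gt0 jn.
have [b E] := coef_two_vars n_gt0 (ltnW jn).
apply/pserP => m; set d := (p * (n - j))%N in E.
have dn : (d < p * n)%N.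
  by rewrite ltn_pmul2l ?prime_gt0 ?(pcharf_prime pk)// -subn_gt0 subKn// ltnW.
(* In degree m + d one gets T^d C(n, j) a_m (1 + T)^m, with a_m the coefficient of q^m in f_n; its
   T^d coefficient vanishes since d < pn. *)
have := coef_lambda_subXM (m + d) b dn; rewrite -E gtn_eqF// mulr0n addr0.
rewrite lambda_subXM leq_addl addnK lambdaMn lambda0_pser_at coefXnM ltnn subnn.
rewrite coefMn coefZ coef_exprXD1 bin0 mulr1 -mulr_natr => /eqP.
by rewrite mulf_eq0 (negbTE Cnj) orbF /= if_same => /eqP.
Qed.

(** For j = n, the part of degree m becomes a_m ((1 + T)^m +- 1), a multiple of T^(pn). At T^(p^v),
    v the valuation of m, the constant from y is absent and a_m has a nonzero binomial factor. *)
Lemma pcoef_taylor_delta_symmetric (n m : nat) :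
  (0 < n)%N -> (0 < m)%N -> (p ^ logn p m < p * n)%N -> pcoef f`_n m = 0.
Proof.
move=> n_gt0 m_gt0 lm; have [b E] := coef_two_vars n_gt0 (leqnn n).
have := coef_lambda_subXM m b lm.
rewrite -E subnn muln0 expr0 mul1r binn mulr1n eqxx mulr1n lambdaD.
rewrite lambda0_pser_at coefD coefZ coef_exprXD1.
have -> : (lambda m ((-1) ^+ n * pser_at i1 f`_n))`_(p ^ logn p m) = 0.
  have q0 : (p ^ logn p m == 0)%N = false.
    by rewrite eqn0Ngt expn_gt0 prime_gt0 ?(pcharf_prime pk).
  rewrite -signr_odd mulr_sign /lambda; case: (odd n).
    by rewrite hpartN raddfN /= -/(lambda _ _) lambda1_pser_at coefN coefC q0 oppr0.
  by rewrite -/(lambda _ _) lambda1_pser_at coefC q0.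
by rewrite addr0 => /eqP; rewrite mulf_eq0 (negbTE (natr_bin_logn pk m_gt0)) orbF => /eqP.
Qed.

End Recognition.

(** * Iterates of V and monomials in Laurent series *)

Lemma coef_lV_iter (R : comNzRingType) (p s : nat) (a : laurent R) (i : int) :
  (0 < p)%N ->
  lcoef (iter s (lV p) a) i
  = if ((p ^ s)%N%:Z %| i)%Z then lcoef a (i %/ (p ^ s)%N%:Z)%Z else 0.
Proof.
move=> p_gt0; elim: s i => [|s IH] i; first by rewrite dvd1z divz1.
have p0 : p%:Z != 0 by lia.
have q0 : (p ^ s)%N%:Z != 0 by have : (0 < p ^ s)%N; [rewrite expn_gt0 p_gt0|lia].
rewrite iterS [LHS]/= IH expnS PoszM.
case: ifP => [/dvdzP[j ->]|pi].
  by rewrite mulzK// mulrC dvdz_mul2l// divzMpl//; lia.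
case: ifP => // /dvdzP[j ij]; move: pi.
by rewrite ij mulrCA dvdz_mulr.
Qed.

Lemma lcoefM_lmono (R : comNzRingType) (a : laurent R) (i j : int) :
  lcoef (a * lmono i) j = lcoef a (j - i).
Proof.
rewrite [LHS]/= /lmul_coef.
rewrite -(fsbig_widen [set (j - i)]%classic)//; last first.
  move=> l [_ /= li]; case: eqP => [E|_]; last exact: mulr0.
  by case: li; rewrite -E subKr.
by rewrite fsbig_set1 subKr /= eqxx mulr1.
Qed.

Lemma lmonoX (R : comNzRingType) (i : int) (n : nat) :
  (lmono i : laurent R) ^+ n = lmono (i * n%:Z).
Proof.
elim: n => [|n IH]; first by rewrite expr0 mulr0 lmono0.
by rewrite exprS IH -lmonoD; congr lmono; lia.
Qed.

Lemma laurent_of_pser0 (R : comNzRingType) : laurent_of_pser (0 : pser R) = 0.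
Proof. by apply/laurentP => i /=; case: (i + 0) => // m; rewrite if_same. Qed.

Lemma lcoef_laurent_of_pser (R : comNzRingType) (x : pser R) (i : int) :
  lcoef (laurent_of_pser x) i = if i is Posz m then pcoef x m else 0.
Proof. by rewrite /= addr0. Qed.

(** * Construction of the series phi and comparison of coefficients *)

Theorem theorem4p1 (p : nat) (k : closedFieldType) (iota : {rmorphism 'F_p -> k})
    (f : {poly (pser k)}) :
  prime p -> (5 <= p)%N ->
  (forall x : k, algebraicOver iota x) ->
  taylor_delta_symmetric p f ->
  exists (phi : nat -> pser k) (N : nat),
    [/\ forall s : nat, exists psi : pser k, phi (p ^ s)%N = pserX * psi,
        forall s : nat, (N <= s)%N -> phi (p ^ s)%N = 0 &
        map_poly laurent_of_pser f =
          (laurent_of_pser (phi 0%N))%:P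
          + \sum_(s < N)
              (iter s.+1 (lV p) (laurent_of_pser (phi (p ^ s)%N)))%:P
              * (lmono (- p%:Z) *: 'X) ^+ (p ^ s)].
Proof.
move=> p_pr p_ge5 _ f_sym.
have p_gt0 := prime_gt0 p_pr; have p_gt1 := prime_gt1 p_pr.
have pk : p \in [pchar k] by rewrite (rmorph_pchar iota)// pchar_Fp.
pose i0 := Ordinal p_gt0; pose i1 := Ordinal p_gt1.
have i01 : i0 != i1 by [].
(* If n is not a power of p, its p-part lies strictly between 0 and n and serves as j. *)
have f0 n : (0 < n)%N -> n != (p ^ logn p n)%N -> f`_n = 0.
  move=> n_gt0 nl; apply: (coef_taylor_delta_symmetric0 pk i01 f_sym _ (natr_bin_logn pk n_gt0)).
  rewrite expn_gt0 p_gt0 ltn_neqAle [_ == n]eq_sym nl/=.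
  by rewrite dvdn_leq// pfactor_dvdnn.
(* For m > 0 of valuation v, p^v < p^(s+1) says exactly that p^(s+1) does not divide m. *)
have fs s m : ~~ (p ^ s.+1 %| m)%N -> pcoef f`_(p ^ s) m = 0.
  case: m => [|m]; first by rewrite dvdn0.
  rewrite pfactor_dvdn// -ltnNge => ms.
  by apply: (pcoef_taylor_delta_symmetric pk i01 f_sym); rewrite ?expn_gt0 ?p_gt0// -expnS ltn_exp2l.
(* For n = p^s, V^(s+1) sends q^(m'+1) to q^(np(m'+1)), and division by q^(np) leaves q^(npm'):
   hence the index shift and the zero constant term. *)
pose phi n : pser k := if n is 0%N then f`_0 else
  PSer (fun m => if m is m'.+1 then pcoef f`_n (n * p * m')%N else 0).
have phiS n : (0 < n)%N ->
    phi n = PSer (fun m => if m is m'.+1 then pcoef f`_n (n * p * m')%N else 0).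
  by case: n.
have ps_gt0 s : (0 < p ^ s)%N by rewrite expn_gt0 p_gt0.
(* Since s < p^s, f_(p^s) = 0 once s reaches [size f]. *)
exists phi, (size f); split=> [s|s fs'|].
- exists (PSer (fun m => pcoef f`_(p ^ s) (p ^ s * p * m)%N)); rewrite phiS//.
  apply/pserP => -[|m] /=; first by rewrite big_ord_recl big_ord0 mul0r addr0.
  rewrite !big_ord_recl big1 /= ?mul0r ?mul1r ?add0r ?addr0 ?subSS ?subn0// => l _.
  by rewrite mul0r.
- rewrite phiS// nth_default; last by apply: leq_trans fs' (ltnW (ltn_expl s p_gt1)).
  by apply/pserP => -[|m] //=; rewrite if_same.
apply/polyP => n; rewrite coef_map_id0 ?laurent_of_pser0// coefD coefC coef_sum.
have termE s : ((iter s.+1 (lV p) (laurent_of_pser (phi (p ^ s)%N)))%:P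
    * (lmono (- p%:Z) *: 'X) ^+ (p ^ s))`_n
    = if n == (p ^ s)%N then laurent_of_pser f`_n else 0.
  rewrite coefCM exprZn coefZ coefXn.
  have [->|_] := eqVneq n (p ^ s)%N; last by rewrite !mulr0.
  rewrite mulr1 lmonoX; apply/laurentP => i; rewrite lcoefM_lmono coef_lV_iter// phiS//.
  set Q := (p ^ s.+1)%N; have Q_gt0 : (0 < Q)%N := ps_gt0 s.+1.
  have -> : i - - p%:Z * (p ^ s)%N%:Z = i + Q%:Z.
    by rewrite mulNr opprK -PoszM -expnS.
  rewrite rpredDr ?dvdzz// !lcoef_laurent_of_pser -expnSr -/Q.
  case: ifP => [/dvdzP[j ->]|Qi].
    have -> : (j * Q%:Z + Q%:Z)%R = (j + 1) * Q%:Z by rewrite mulrDl mul1r.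
    rewrite mulzK; last by lia.
    case: j => [j|j].
      have -> : j%:Z + 1 = j.+1%:Z by lia.
      by rewrite -PoszM /= mulnC.
    (* Negative exponents: j = -1 meets the zero constant term of phi, smaller j no term at all. *)
    have [c ->] : exists c, Negz j * Q%:Z = Negz c by exists (j.+1 * Q).-1; lia.
    by case: j => [|j] //.
  case: i Qi => // m Qm; by rewrite fs//; apply/negbT.
under eq_bigr => s _ do rewrite termE.
have [->|n_gt0] := posnP n.
  by rewrite /= big1 ?addr0// => s _; rewrite ltn_eqF.
rewrite /= add0r.
have [nl|/(f0 _ n_gt0) fn] := eqVneq n (p ^ logn p n)%N; last first.
  by rewrite fn laurent_of_pser0 big1// => s _; rewrite if_same.
have [nf|fn] := ltnP n (size f); last first.
  by rewrite nth_default// laurent_of_pser0 big1// => s _; rewrite if_same.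
(* The only summand that contributes to q'^n has index [logn p n], which is below n and so within
   range. *)
have ln : (logn p n < size f)%N by apply: leq_trans nf; rewrite ltnS {2}nl ltnW// ltn_expl.
rewrite (bigD1 (Ordinal ln))//= -nl eqxx big1 ?addr0// => s.
rewrite -val_eqE /= => sn; case: eqP => // ns; case/eqP: sn.
by rewrite ns pfactorK.
Qed.
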